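(* Let $(\mathbf A,\mathbf n)$ be a Nelson conucleus algebra and let $\imath=\mathbf n(\sim e)$. The function $\phi_{(\mathbf A,\mathbf n)}:A\to \mathrm{Tw}(\mathbf A_{\mathbf n},\imath)$ given by $$x\mapsto(\mathbf n(x),\mathbf n(\sim x))$$ is an injective homomorphism from $(\mathbf A,\mathbf n)$ to $(\mathbf{Tw}(\mathbf A_{\mathbf n},\imath),\mathbf n_{\mathrm{Tw}})$ (with respect to all the operations $\wedge,\vee,\cdot,\backslash,/,\sim,e$ and the unary operation given by the conucleus). In particular, $(\mathbf A,\mathbf n)$ is isomorphic to a twist-product over $(\mathbf A_{\mathbf n},\imath)$.
   Context: A residuated lattice is an algebra $(A,\wedge,\vee,\cdot,\backslash,/,e)$ such that $(A,\wedge,\vee)$ is a lattice, $(A,\cdot,e)$ is a monoid, and $xy\le z$ iff $y\le x\backslash z$ iff $x\le z/y$. An involutive residuated lattice (always cyclic) is a residuated lattice with a unary operation $\sim$ satisfying $\sim\sim x=x$ and $x\backslash\sim y=\sim x/y$. An element $\imath$ of a residuated lattice is cyclic if $x\backslash\imath=\imath/x$ for all $x$. A conucleus on a residuated lattice $\mathbf A$ is a map $\delta:A\to A$ such that $\delta(x)\le x$; $\delta(\delta(x))=\delta(x)$; $x\le y$ implies $\delta(x)\le\delta(y)$; $\delta(x)\delta(y)\le\delta(xy)$; and $\delta(e)\delta(x)=\delta(x)\delta(e)=\delta(x)$. A Nelson conucleus on $\mathbf A$ is a conucleus $\mathbf n$ that also satisfies $\mathbf n(x\vee y)=\mathbf n(x)\vee\mathbf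 n(y)$, $\mathbf n(xy)=\mathbf n(x)\mathbf n(y)$ and $xy\le \mathbf n(x)y\vee x\mathbf n(y)$ (one then has $\mathbf n(e)=e$). A Nelson conucleus algebra is a pair $(\mathbf A,\mathbf n)$ where $\mathbf A$ is a (cyclic) involutive residuated lattice and $\mathbf n$ is a Nelson conucleus on $\mathbf A$. The conucleus image is the residuated lattice $\mathbf A_{\mathbf n}=(\mathbf n[A],\wedge_{\mathbf n},\vee,\cdot,\backslash_{\mathbf n},/_{\mathbf n},e)$, where $x\wedge_{\mathbf n}y=\mathbf n(x\wedge y)$, $x\backslash_{\mathbf n}y=\mathbf n(x\backslash y)$, $y/_{\mathbf n}x=\mathbf n(y/x)$. The element $\mathbf n(\sim e)$ is cyclic in $\mathbf A_{\mathbf n}$. For a residuated lattice $\mathbf L$ and a cyclic $\imath\in L$, $\mathbf{Tw}(\mathbf L,\imath)$ is the involutive residuated lattice with universe $\{(a,b)\in L\times L: ab\vee ba\le\imath\}$, operations $(a,b)\wedge(a',b')=(a\wedge a',b\vee b')$, $(a,b)\vee(a',b')=(a\vee a',b\wedge b')$, $\sim(a,b)=(b,a)$, $(a,b)\cdot(a',b')=(aa',(b'/a)\wedge(a'\backslash b))$, $(a,b)\backslash(a',b')=((a\backslash a')\wedge(b/b'),b'a)$, $(a',b')/(a,b)=((a'/a)\wedge(b'\backslash b),ab')$, and identity $(e,\imath)$. On it, $\mathbf n_{\mathrm{Tw}}(a,b)=(a,(\imath/a)\wedge(a\backslash\imath))=(a,a\backslash\imath)$, which is a Nelson conucleus. A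 twist-product over $(\mathbf L,\imath)$ is a subalgebra of $\mathbf{Tw}(\mathbf L,\imath)$ that contains all elements $(a,(\imath/a)\wedge(a\backslash\imath))$ for $a\in L$; it is regarded as equipped with the restriction of $\mathbf n_{\mathrm{Tw}}$. *)

(* Defs.v *)
From HB Require Import structures.
From mathcomp Require Import all_boot all_order.
From mathcomp Require Import boolp classical_sets.

Set Implicit Arguments.
Unset Strict Implicit.
Unset Printing Implicit Defensive.

Import Order.Theory.

Local Open Scope group_scope.
Local Open Scope order_scope.

(* The lattice is MathComp's [latticeType]: [`&`] is meet, [`|`] is join.  The
   monoid is MathComp's [monoidType]: multiplication [x * y] and identity [1]
   (the element e), in [group_scope]. *)

Reserved Notation "x \ld y" (at level 40, left associativity).
Reserved Notation "x \rd y" (at level 40, left associativity).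

HB.mixin Record LatticeMonoid_isResiduated d A
    of Order.Lattice d A & monoid.Monoid A := {
  ldiv : A -> A -> A;
  rdiv : A -> A -> A;
  ldivP : forall x y z : A, (x * y <= z) = (y <= ldiv x z);
  rdivP : forall x y z : A, (x * y <= z) = (x <= rdiv z y);
}.

#[short(type="residLatticeType")]
HB.structure Definition ResidLattice d :=
  { A of Order.Lattice d A & monoid.Monoid A & LatticeMonoid_isResiduated d A }.

(* [x \ld z] is x\z and [z \rd y] is z/y. *)
Notation "x \ld y" := (ldiv x y) : order_scope.
Notation "x \rd y" := (rdiv x y) : order_scope.

HB.mixin Record ResidLattice_isInvolutive d A of ResidLattice d A := {
  neg : A -> A;
  negK : forall x : A, neg (neg x) = x;
  ldiv_neg : forall x y : A, x \ld neg y = neg x \rd y;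
}.

#[short(type="invResidLatticeType")]
HB.structure Definition InvResidLattice d :=
  { A of ResidLattice d A & ResidLattice_isInvolutive d A }.

Definition cyclic_elt d (L : residLatticeType d) (i : L) : Prop :=
  forall x : L, x \ld i = i \rd x.

HB.mixin Record isConucleus d (A : residLatticeType d) (f : A -> A) := {
  conuc_le : forall x, f x <= x;
  conuc_idem : forall x, f (f x) = f x;
  conuc_homo : forall x y, x <= y -> f x <= f y;
  conuc_mul_le : forall x y, f x * f y <= f (x * y);
  conuc_1l : forall x, f 1 * f x = f x;
  conuc_1r : forall x, f x * f 1 = f x;
}.

#[short(type="conucleus")]
HB.structure Definition Conucleus d (A : residLatticeType d) :=
  { f of isConucleus d A f }.

HB.mixin Record Conucleus_isNelson d (A : residLatticeType d) (f : A -> A)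
    of isConucleus d A f := {
  nelsonU : forall x y, f (x `|` y) = f x `|` f y;
  nelsonM : forall x y, f (x * y) = f x * f y;
  nelson_mul_le : forall x y, x * y <= (f x * y) `|` (x * f y);
}.

(* A Nelson conucleus algebra is a pair [A : invResidLatticeType d] and
   [n : nelsonConucleus A]. *)
#[short(type="nelsonConucleus")]
HB.structure Definition NelsonConucleus d (A : residLatticeType d) :=
  { f of isConucleus d A f & Conucleus_isNelson d A f }.

Record nelson_hom d d' (A : invResidLatticeType d) (B : invResidLatticeType d')
    (nA : nelsonConucleus A) (nB : nelsonConucleus B) (f : A -> B) : Prop :=
  NelsonHom {
    homI : forall x y, f (x `&` y) = f x `&` f y;
    homU : forall x y, f (x `|` y) = f x `|` f y;
    homM : forall x y, f (x * y) = f x * f y;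
    hom_ld : forall x y, f (x \ld y) = f x \ld f y;
    hom_rd : forall x y, f (x \rd y) = f x \rd f y;
    hom_neg : forall x, f (neg x) = neg (f x);
    hom1 : f 1 = 1;
    hom_conuc : forall x, f (nA x) = nB (f x);
  }.

Definition nelson_iso d d' (A : invResidLatticeType d)
    (B : invResidLatticeType d') (nA : nelsonConucleus A)
    (nB : nelsonConucleus B) (f : A -> B) : Prop :=
  nelson_hom nA nB f /\ bijective f.

Section ResidTheory.
Context (d : Order.disp_t) (L : residLatticeType d).
Implicit Types x y z a b : L.

Lemma eq_from_le x y : (forall z, (z <= x) = (z <= y)) -> x = y.
Proof. by move=> h; apply/le_anti; rewrite -h lexx h lexx. Qed.

Lemma mul_mono a b x y : a <= b -> x <= y -> a * x <= b * y.
Proof.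
move=> ab xy; apply: (@le_trans _ _ (b * x)).
  by rewrite rdivP; apply: (le_trans ab); rewrite -rdivP.
by rewrite ldivP; apply: (le_trans xy); rewrite -ldivP.
Qed.

Lemma mul_ldiv_le x y : x * (x \ld y) <= y.
Proof. by rewrite ldivP. Qed.

Lemma rdiv_mul_le x y : (y \rd x) * x <= y.
Proof. by rewrite rdivP. Qed.

Lemma ldiv_le x y z : x <= y -> y \ld z <= x \ld z.
Proof.
by move=> xy; rewrite -ldivP; apply: le_trans (mul_ldiv_le y z); apply: mul_mono.
Qed.

Lemma cyclic_swap (i : L) x y : cyclic_elt i -> (x * y <= i) = (y * x <= i).
Proof. by move=> ic; rewrite ldivP ic rdivP. Qed.

End ResidTheory.

Section ConucleusImage.
Context (d : Order.disp_t) (A : residLatticeType d) (n : nelsonConucleus A).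

Lemma nelson1 : n 1 = 1.
Proof.
apply/le_anti/andP; split; first exact: conuc_le.
by have := @nelson_mul_le _ _ n 1 1; rewrite !mulg1 mul1g joinxx.
Qed.

Definition conuc_image : Type := set_type (range n).

HB.instance Definition _ := Choice.on conuc_image.
HB.instance Definition _ := SubType.on conuc_image.
HB.instance Definition _ := [SubChoice_isSubPOrder of conuc_image by <: with d].

Definition corestr (x : A) : conuc_image :=
  exist _ (n x) (mem_set (ex_intro2 _ _ x I erefl)).

Implicit Types x y z : conuc_image.

Lemma corestr_fix x : n (val x) = val x.
Proof. by case: x => /= x xP; case: (set_mem xP) => a _ <-; apply: conuc_idem. Qed.

Lemma image_mem (a : A) : n a = a -> a \in range n.
Proof. by move=> na; apply/mem_set; exists a. Qed.

Lemma image_joinP x y : n (val x `|` val y) = val x `|` val y.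
Proof. by rewrite nelsonU !corestr_fix. Qed.

Lemma image_mulP x y : n (val x * val y) = val x * val y.
Proof. by rewrite nelsonM !corestr_fix. Qed.

(* The order is the restriction of that of A, and it is also the order of the
   lattice below: for x, y in n[A], n(x /\ y) = x iff x <= y. *)
Definition image_meet x y : conuc_image := corestr (val x `&` val y).
Definition image_join x y : conuc_image :=
  exist _ (val x `|` val y) (image_mem (image_joinP x y)).
Definition image_mul x y : conuc_image :=
  exist _ (val x * val y) (image_mem (image_mulP x y)).
Definition image_one : conuc_image := exist _ 1 (image_mem nelson1).
Definition image_ldiv x y : conuc_image := corestr (val x \ld val y).
Definition image_rdiv y x : conuc_image := corestr (val y \rd val x).

Lemma le_corestr x (a : A) : (x <= corestr a) = (val x <= a).
Proof.
rewrite -Order.le_val /=; apply/idP/idP => h; first exact: le_trans h (conuc_le _).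
by rewrite -corestr_fix; apply: conuc_homo.
Qed.

Lemma image_meetE x y z : (x <= image_meet y z) = (x <= y) && (x <= z).
Proof. by rewrite le_corestr lexI !Order.le_val. Qed.

Lemma image_joinE x y z : (image_join x y <= z) = (x <= z) && (y <= z).
Proof. by rewrite -!Order.le_val /= leUx. Qed.

HB.instance Definition _ := Order.POrder_MeetJoin_isLattice.Build d conuc_image
  image_meetE image_joinE.

Lemma image_mulA : associative image_mul.
Proof. by move=> x y z; apply: val_inj; rewrite /= mulgA. Qed.
Lemma image_mul1 : left_id image_one image_mul.
Proof. by move=> x; apply: val_inj; rewrite /= mul1g. Qed.
Lemma image_1mul : right_id image_one image_mul.
Proof. by move=> x; apply: val_inj; rewrite /= mulg1. Qed.

HB.instance Definition _ :=
  monoid.isMonoid.Build conuc_image image_mulA image_mul1 image_1mul.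

Lemma image_ldivP x y z : (x * y <= z) = (y <= image_ldiv x z).
Proof. by rewrite le_corestr -Order.le_val; apply: ldivP. Qed.
Lemma image_rdivP x y z : (x * y <= z) = (x <= image_rdiv z y).
Proof. by rewrite le_corestr -Order.le_val; apply: rdivP. Qed.

HB.instance Definition _ :=
  LatticeMonoid_isResiduated.Build d conuc_image image_ldivP image_rdivP.

End ConucleusImage.

Section TwistStructure.
Context (d : Order.disp_t) (L : residLatticeType d) (i : L).
Context (ic : cyclic_elt i).

Definition tw_mem : pred (L * L) := fun p => p.1 * p.2 `|` p.2 * p.1 <= i.

(* The proof of cyclicity is a parameter because the instances below need it. *)
Definition Tw of cyclic_elt i : Type := {p : L * L | tw_mem p}.

Local Notation T := (Tw ic).

HB.instance Definition _ := Choice.on T.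
HB.instance Definition _ := SubType.on T.

Implicit Types p q r : T.

Local Notation lft p := (val p).1.
Local Notation rgt p := (val p).2.

Lemma tw_memP a b : tw_mem (a, b) = (a * b <= i).
Proof. by rewrite /tw_mem /= leUx (cyclic_swap b) // andbb. Qed.

Lemma tw_swap a b : tw_mem (a, b) -> tw_mem (b, a).
Proof. by rewrite /tw_mem /= joinC. Qed.

Lemma twP p : lft p * rgt p <= i.
Proof. by case: p => [[a b] /=]; rewrite tw_memP. Qed.

Definition tw_le p q := (lft p <= lft q) && (rgt q <= rgt p).

Lemma tw_le_refl : reflexive tw_le.
Proof. by move=> p; rewrite /tw_le !lexx. Qed.
Lemma tw_le_anti : antisymmetric tw_le.
Proof.
move=> p q /andP[/andP[a b] /andP[a' b']]; apply: val_inj.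
rewrite [val p]surjective_pairing [val q]surjective_pairing.
by congr pair; apply/le_anti/andP.
Qed.
Lemma tw_le_trans : transitive tw_le.
Proof.
move=> q p r /andP[a b] /andP[a' b']; apply/andP; split.
  exact: le_trans a a'.
exact: le_trans b' b.
Qed.

HB.instance Definition _ :=
  Order.Le_isPOrder.Build d T tw_le_refl tw_le_anti tw_le_trans.

Lemma tw_neg_mem p : tw_mem (rgt p, lft p).
Proof. by case: p => [[a b] /= /tw_swap]. Qed.

Lemma tw_meet_mem p q : tw_mem (lft p `&` lft q, rgt p `|` rgt q).
Proof.
rewrite tw_memP ldivP leUx -!ldivP; apply/andP; split.
  by apply: le_trans (twP p); apply: mul_mono; rewrite ?leIl.
by apply: le_trans (twP q); apply: mul_mono; rewrite ?leIr.
Qed.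

Lemma tw_join_mem p q : tw_mem (lft p `|` lft q, rgt p `&` rgt q).
Proof.
rewrite tw_memP rdivP leUx -!rdivP; apply/andP; split.
  by apply: le_trans (twP p); apply: mul_mono; rewrite ?leIl.
by apply: le_trans (twP q); apply: mul_mono; rewrite ?leIr.
Qed.

Lemma tw_mul_mem p q :
  tw_mem (lft p * lft q, (rgt q \rd lft p) `&` (lft q \ld rgt p)).
Proof.
rewrite tw_memP -mulgA; apply: le_trans (twP p); apply: mul_mono => //.
by rewrite ldivP leIr.
Qed.

Lemma tw_ldiv_mem p q :
  tw_mem ((lft p \ld lft q) `&` (rgt p \rd rgt q), rgt q * lft p).
Proof.
apply: tw_swap; rewrite tw_memP -mulgA cyclic_swap //.
apply: le_trans (twP q); apply: mul_mono => //.
by rewrite ldivP leIl.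
Qed.

Lemma tw_rdiv_mem q p :
  tw_mem ((lft q \rd lft p) `&` (rgt q \ld rgt p), lft p * rgt q).
Proof.
rewrite tw_memP mulgA; apply: le_trans (twP q); apply: mul_mono => //.
by rewrite rdivP leIl.
Qed.

Lemma tw_one_mem : tw_mem (1, i).
Proof. by rewrite tw_memP mul1g. Qed.

Definition tw_meet p q : T :=
  exist _ (lft p `&` lft q, rgt p `|` rgt q) (tw_meet_mem p q).
Definition tw_join p q : T :=
  exist _ (lft p `|` lft q, rgt p `&` rgt q) (tw_join_mem p q).
Definition tw_neg p : T := exist _ (rgt p, lft p) (tw_neg_mem p).
Definition tw_mul p q : T :=
  exist _ (lft p * lft q, (rgt q \rd lft p) `&` (lft q \ld rgt p))
    (tw_mul_mem p q).
Definition tw_ldiv p q : T :=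
  exist _ ((lft p \ld lft q) `&` (rgt p \rd rgt q), rgt q * lft p)
    (tw_ldiv_mem p q).
Definition tw_rdiv q p : T :=
  exist _ ((lft q \rd lft p) `&` (rgt q \ld rgt p), lft p * rgt q)
    (tw_rdiv_mem q p).
Definition tw_one : T := exist _ (1, i) tw_one_mem.

Lemma tw_meetP p q r : (p <= tw_meet q r) = (p <= q) && (p <= r).
Proof.
by rewrite /Order.le /= /tw_le /= lexI leUx andbACA.
Qed.
Lemma tw_joinP p q r : (tw_join p q <= r) = (p <= r) && (q <= r).
Proof.
by rewrite /Order.le /= /tw_le /= lexI leUx andbACA.
Qed.

HB.instance Definition _ :=
  Order.POrder_MeetJoin_isLattice.Build d T tw_meetP tw_joinP.

Lemma tw_eq p q : lft p = lft q -> rgt p = rgt q -> p = q.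
Proof.
move=> a b; apply: val_inj.
by rewrite [val p]surjective_pairing [val q]surjective_pairing a b.
Qed.

Lemma tw_mulA : associative tw_mul.
Proof.
move=> p q r; apply: tw_eq => /=; first by rewrite mulgA.
apply: eq_from_le => z.
by rewrite lexI -rdivP lexI -rdivP -!ldivP !lexI -rdivP -ldivP lexI -rdivP
  -ldivP !mulgA -andbA.
Qed.

Lemma tw_mul1 : left_id tw_one tw_mul.
Proof.
move=> p; apply: tw_eq => /=; first by rewrite mul1g.
apply: eq_from_le => z; rewrite lexI -rdivP mulg1 -ldivP andb_idr // => h.
by apply: le_trans (twP p); apply: mul_mono.
Qed.

Lemma tw_1mul : right_id tw_one tw_mul.
Proof.
move=> p; apply: tw_eq => /=; first by rewrite mulg1.
apply: eq_from_le => z; rewrite lexI -rdivP -ldivP mul1g andb_idl // => h.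
by rewrite cyclic_swap //; apply: le_trans (twP p); apply: mul_mono.
Qed.

HB.instance Definition _ := monoid.isMonoid.Build T tw_mulA tw_mul1 tw_1mul.

Lemma tw_ldivP p q r : (p * q <= r) = (q <= tw_ldiv p r).
Proof.
rewrite /Order.le /= /tw_le /= !lexI -!rdivP -!ldivP -andbA.
by rewrite [X in _ && X]andbC.
Qed.

Lemma tw_rdivP p q r : (p * q <= r) = (p <= tw_rdiv r q).
Proof.
by rewrite /Order.le /= /tw_le /= !lexI -!rdivP -!ldivP -andbA.
Qed.

HB.instance Definition _ :=
  LatticeMonoid_isResiduated.Build d T tw_ldivP tw_rdivP.

Lemma tw_negK p : tw_neg (tw_neg p) = p.
Proof. exact: tw_eq. Qed.
Lemma tw_ldiv_neg p q : p \ld tw_neg q = tw_neg p \rd q.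
Proof. by apply: tw_eq => //=; rewrite meetC. Qed.

HB.instance Definition _ :=
  ResidLattice_isInvolutive.Build d T tw_negK tw_ldiv_neg.

Lemma tw_emb_mem a : tw_mem (a, (i \rd a) `&` (a \ld i)).
Proof. by rewrite tw_memP ldivP leIr. Qed.

Definition tw_emb a : T := exist _ (a, (i \rd a) `&` (a \ld i)) (tw_emb_mem a).

Definition n_Tw p : T := tw_emb (lft p).

Lemma n_Tw_le p : n_Tw p <= p.
Proof.
by rewrite /Order.le /= /tw_le /= lexx lexI -rdivP -ldivP cyclic_swap // twP.
Qed.

Lemma n_Tw_idem p : n_Tw (n_Tw p) = n_Tw p.
Proof. by []. Qed.

Lemma n_Tw_homo p q : p <= q -> n_Tw p <= n_Tw q.
Proof.
move=> /andP[h _]; rewrite /Order.le /= /tw_le /= h /=.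
by rewrite -!ic !meetxx ldiv_le.
Qed.

Lemma n_TwM p q : n_Tw (p * q) = n_Tw p * n_Tw q.
Proof.
apply: tw_eq => //=; apply: eq_from_le => z.
rewrite -!ic !meetxx lexI -ldivP -rdivP -!ldivP !mulgA andb_idl // => h.
by rewrite cyclic_swap // mulgA.
Qed.

Lemma n_TwU p q : n_Tw (p `|` q) = n_Tw p `|` n_Tw q.
Proof.
apply: tw_eq => //=; apply: eq_from_le => z.
by rewrite -!ic !meetxx lexI -!ldivP rdivP leUx -!rdivP.
Qed.

Lemma n_Tw_mul_le p q : n_Tw p * n_Tw q <= n_Tw (p * q).
Proof. by rewrite n_TwM. Qed.

Lemma n_Tw1 : n_Tw 1 = 1.
Proof.
apply: tw_eq => //=; rewrite -ic meetxx; apply: eq_from_le => z.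
by rewrite -ldivP mul1g.
Qed.

Lemma n_Tw_1l p : n_Tw 1 * n_Tw p = n_Tw p.
Proof. by rewrite n_Tw1 mul1g. Qed.
Lemma n_Tw_1r p : n_Tw p * n_Tw 1 = n_Tw p.
Proof. by rewrite n_Tw1 mulg1. Qed.

HB.instance Definition _ := isConucleus.Build d T n_Tw
  n_Tw_le n_Tw_idem n_Tw_homo n_Tw_mul_le n_Tw_1l n_Tw_1r.

Lemma n_Tw_nelson p q : p * q <= (n_Tw p * q) `|` (p * n_Tw q).
Proof.
rewrite /Order.le /= /tw_le /= lexU2 ?lexx //= lexI.
apply/andP; split; first by rewrite -meetA leIl.
by rewrite meetA leIr.
Qed.

HB.instance Definition _ := Conucleus_isNelson.Build d T n_Tw
  n_TwU n_TwM n_Tw_nelson.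

End TwistStructure.

Arguments n_Tw {d L i} ic p.

Section Subalgebra.
Context (d : Order.disp_t) (B : invResidLatticeType d).

Record subalgebra := Subalgebra {
  sub_set : set B;
  subI : forall x y, sub_set x -> sub_set y -> sub_set (x `&` y);
  subU : forall x y, sub_set x -> sub_set y -> sub_set (x `|` y);
  subM : forall x y, sub_set x -> sub_set y -> sub_set (x * y);
  sub_ld : forall x y, sub_set x -> sub_set y -> sub_set (x \ld y);
  sub_rd : forall x y, sub_set x -> sub_set y -> sub_set (x \rd y);
  sub_neg : forall x, sub_set x -> sub_set (neg x);
  sub1 : sub_set 1;
}.

Context (S : subalgebra).

Definition sub_carrier : Type := set_type (sub_set S).

HB.instance Definition _ := Choice.on sub_carrier.
HB.instance Definition _ := SubType.on sub_carrier.
HB.instance Definition _ := [SubChoice_isSubPOrder of sub_carrier by <: with d].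

Implicit Types x y z : sub_carrier.

Lemma sub_memP x : sub_set S (val x).
Proof. exact/set_mem/valP. Qed.

Definition sub_mk (b : B) (h : sub_set S b) : sub_carrier :=
  exist _ b (mem_set h).

Definition sub_meet x y := sub_mk (subI (sub_memP x) (sub_memP y)).
Definition sub_join x y := sub_mk (subU (sub_memP x) (sub_memP y)).
Definition sub_mul x y := sub_mk (subM (sub_memP x) (sub_memP y)).
Definition sub_ldiv x y := sub_mk (sub_ld (sub_memP x) (sub_memP y)).
Definition sub_rdiv x y := sub_mk (sub_rd (sub_memP x) (sub_memP y)).
Definition sub_opp x := sub_mk (sub_neg (sub_memP x)).
Definition sub_one := sub_mk (sub1 S).

Lemma sub_meetP x y z : (x <= sub_meet y z) = (x <= y) && (x <= z).
Proof. by rewrite -!Order.le_val /= lexI. Qed.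
Lemma sub_joinP x y z : (sub_join x y <= z) = (x <= z) && (y <= z).
Proof. by rewrite -!Order.le_val /= leUx. Qed.

HB.instance Definition _ :=
  Order.POrder_MeetJoin_isLattice.Build d sub_carrier sub_meetP sub_joinP.

Lemma sub_mulA : associative sub_mul.
Proof. by move=> x y z; apply: val_inj; rewrite /= mulgA. Qed.
Lemma sub_mul1 : left_id sub_one sub_mul.
Proof. by move=> x; apply: val_inj; rewrite /= mul1g. Qed.
Lemma sub_1mul : right_id sub_one sub_mul.
Proof. by move=> x; apply: val_inj; rewrite /= mulg1. Qed.

HB.instance Definition _ :=
  monoid.isMonoid.Build sub_carrier sub_mulA sub_mul1 sub_1mul.

Lemma sub_ldivP x y z : (x * y <= z) = (y <= sub_ldiv x z).
Proof. by rewrite -!Order.le_val; apply: ldivP. Qed.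
Lemma sub_rdivP x y z : (x * y <= z) = (x <= sub_rdiv z y).
Proof. by rewrite -!Order.le_val; apply: rdivP. Qed.

HB.instance Definition _ :=
  LatticeMonoid_isResiduated.Build d sub_carrier sub_ldivP sub_rdivP.

Lemma sub_negK x : sub_opp (sub_opp x) = x.
Proof. by apply: val_inj; rewrite /= negK. Qed.
Lemma sub_ldiv_neg x y : x \ld sub_opp y = sub_opp x \rd y.
Proof. by apply: val_inj; rewrite /= ldiv_neg. Qed.

HB.instance Definition _ :=
  ResidLattice_isInvolutive.Build d sub_carrier sub_negK sub_ldiv_neg.

End Subalgebra.

Section TwistProduct.
Context (d : Order.disp_t) (L : residLatticeType d) (i : L).
Context (ic : cyclic_elt i).

Record twist_product := TwistProduct {
  tp_sub :> subalgebra (Tw ic);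
  tp_emb : forall a : L, sub_set tp_sub (tw_emb ic a);
}.

Context (S : twist_product).
Local Notation C := (sub_carrier S).
Implicit Types x y : C.

Definition n_tp x : C :=
  sub_mk (tp_emb S (val (val x)).1 : sub_set S (n_Tw ic (val x))).

Lemma n_tp_le x : n_tp x <= x.
Proof. by rewrite -Order.le_val; apply: conuc_le. Qed.
Lemma n_tp_idem x : n_tp (n_tp x) = n_tp x.
Proof. by apply: val_inj; apply: (@conuc_idem _ _ (n_Tw ic)). Qed.
Lemma n_tp_homo x y : x <= y -> n_tp x <= n_tp y.
Proof. by rewrite -!Order.le_val; apply: (@conuc_homo _ _ (n_Tw ic)). Qed.
Lemma n_tpM x y : n_tp (x * y) = n_tp x * n_tp y.
Proof. by apply: val_inj; apply: n_TwM. Qed.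
Lemma n_tpU x y : n_tp (x `|` y) = n_tp x `|` n_tp y.
Proof. by apply: val_inj; apply: n_TwU. Qed.
Lemma n_tp_mul_le x y : n_tp x * n_tp y <= n_tp (x * y).
Proof. by rewrite n_tpM. Qed.
Lemma n_tp_1l x : n_tp 1 * n_tp x = n_tp x.
Proof. by rewrite -n_tpM mul1g. Qed.
Lemma n_tp_1r x : n_tp x * n_tp 1 = n_tp x.
Proof. by rewrite -n_tpM mulg1. Qed.

HB.instance Definition _ := isConucleus.Build d C n_tp
  n_tp_le n_tp_idem n_tp_homo n_tp_mul_le n_tp_1l n_tp_1r.

Lemma n_tp_nelson x y : x * y <= (n_tp x * y) `|` (x * n_tp y).
Proof. by rewrite -Order.le_val; apply: n_Tw_nelson. Qed.

HB.instance Definition _ := Conucleus_isNelson.Build d C n_tp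
  n_tpU n_tpM n_tp_nelson.

End TwistProduct.

Arguments n_tp {d L i ic} S x.

Section NelsonTwist.
Context (d : Order.disp_t) (A : invResidLatticeType d) (n : nelsonConucleus A).

Definition nelson_iota : conuc_image n := corestr n (neg 1).

Lemma mul_le_neg1 (x y : A) : (x * y <= neg 1) = (y <= neg x).
Proof. by rewrite ldivP ldiv_neg -rdivP mulg1. Qed.

Lemma mul_le_neg1' (x y : A) : (x * y <= neg 1) = (x <= neg y).
Proof. by rewrite rdivP -ldiv_neg -ldivP mul1g. Qed.

Lemma nelson_iota_cyclic : cyclic_elt nelson_iota.
Proof.
move=> x; apply: eq_from_le => z.
by rewrite -ldivP -rdivP !le_corestr mul_le_neg1 mul_le_neg1'.
Qed.

Lemma nelson_phi_mem (x : A) :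
  tw_mem nelson_iota (corestr n x, corestr n (neg x)).
Proof.
rewrite (tw_memP nelson_iota_cyclic) -Order.le_val /= -nelsonM.
by apply: conuc_homo; rewrite mul_le_neg1.
Qed.

Definition nelson_phi (x : A) : Tw nelson_iota_cyclic :=
  exist _ (corestr n x, corestr n (neg x)) (nelson_phi_mem x).

End NelsonTwist.

Arguments nelson_iota_cyclic {d A} n.

(* Main.v *)
Require Import Defs.
From mathcomp Require Import all_boot all_order.
From mathcomp Require Import boolp classical_sets.

(** In an involutive residuated lattice [x <= y] iff [x * neg y <= neg 1], and
    the factors of a product below [neg 1] may be permuted cyclically.  The
    Nelson inequality says that [x * y * z <= neg 1] as soon as [n x * y * z]
    and [x * n y * z] are below [neg 1].  For [z] in the image of [n] these two
    conditions define the second component of a product in the twist-product;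
    applied to [x * neg y] they show that [(n x, n (neg x))] determines [x]. *)

Set Implicit Arguments.
Unset Strict Implicit.
Unset Printing Implicit Defensive.

Import Order.Theory.

Local Open Scope group_scope.
Local Open Scope order_scope.

Section InvolutiveTheory.
Context (d : Order.disp_t) (A : invResidLatticeType d).
Implicit Types x y z : A.

Lemma le_negC x y : (x <= neg y) = (y <= neg x).
Proof. by rewrite -mul_le_neg1' mul_le_neg1. Qed.

Lemma mulC_le_neg1 x y : (x * y <= neg 1) = (y * x <= neg 1).
Proof. by rewrite mul_le_neg1 mul_le_neg1'. Qed.

Lemma le_mul_neg x y : (x <= y) = (x * neg y <= neg 1).
Proof. by rewrite mul_le_neg1' negK. Qed.

Lemma neg_meet x y : neg (x `&` y) = neg x `|` neg y.
Proof.
have anti (u v : A) : (neg u <= neg v) = (v <= u) by rewrite le_negC negK.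
apply: (can_inj (@negK _ A)); apply: eq_from_le => z.
by rewrite negK lexI -[in RHS](negK z) anti leUx !anti.
Qed.

Lemma neg_join x y : neg (x `|` y) = neg x `&` neg y.
Proof. by rewrite -[RHS]negK neg_meet !negK. Qed.

(** [x * z <= y] iff [x * z * neg y <= neg 1]; rotating [neg y] to the front isolates [z]. *)
Lemma ldivE x y : x \ld y = neg (neg y * x).
Proof.
apply: eq_from_le => z.
by rewrite -ldivP le_mul_neg mulC_le_neg1 -[RHS]mul_le_neg1 mulgA.
Qed.

Lemma rdivE x y : y \rd x = neg (x * neg y).
Proof.
by apply: eq_from_le => z; rewrite -rdivP le_mul_neg -[RHS]mul_le_neg1' mulgA.
Qed.

End InvolutiveTheory.

Section HomImage.
Context (d d' : Order.disp_t).
Context (A : invResidLatticeType d) (B : invResidLatticeType d').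
Context (nA : nelsonConucleus A) (nB : nelsonConucleus B) (f : A -> B).

(** Join and both residuals are terms in meet, product and [neg], by De Morgan and [ldivE],
    [rdivE]. *)
Lemma nelson_hom_of_meet_mul_neg :
  (forall x y, f (x `&` y) = f x `&` f y) ->
  (forall x y, f (x * y) = f x * f y) ->
  (forall x, f (neg x) = neg (f x)) ->
  f 1 = 1 -> (forall x, f (nA x) = nB (f x)) -> nelson_hom nA nB f.
Proof.
move=> fI fM fN f1 fn; split=> // x y.
- by rewrite -[x `|` y]negK neg_join fN fI !fN neg_meet !negK.
- by rewrite !ldivE fN fM fN.
- by rewrite !rdivE fN fM fN.
Qed.

Context (hf : nelson_hom nA nB f).

(** Kept transparent so that [sub_set hom_range] unfolds to [range f]. *)
Definition hom_range : subalgebra B.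
Proof.
exists (range f).
- by move=> _ _ [x _ <-] [y _ <-]; exists (x `&` y); rewrite ?(homI hf).
- by move=> _ _ [x _ <-] [y _ <-]; exists (x `|` y); rewrite ?(homU hf).
- by move=> _ _ [x _ <-] [y _ <-]; exists (x * y); rewrite ?(homM hf).
- by move=> _ _ [x _ <-] [y _ <-]; exists (x \ld y); rewrite ?(hom_ld hf).
- by move=> _ _ [x _ <-] [y _ <-]; exists (x \rd y); rewrite ?(hom_rd hf).
- by move=> _ [x _ <-]; exists (neg x); rewrite ?(hom_neg hf).
- by exists 1; rewrite ?(hom1 hf).
Defined.

Definition hom_corestr (x : A) : sub_carrier hom_range :=
  @sub_mk _ _ hom_range (f x) (ex_intro2 _ _ x I erefl).

Lemma hom_corestr_bij : injective f -> bijective hom_corestr.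
Proof.
move=> f_inj.
have f_surj (c : sub_carrier hom_range) : {x | f x = val c}.
  (* Membership is a mere proposition, so a preimage is picked by choice. *)
  by apply: cid; have [x _ fx] := sub_memP c; exists x.
exists (fun c => sval (f_surj c)) => [x|c]; last first.
  by apply: val_inj => /=; case: (f_surj c).
by apply: f_inj; case: (f_surj _).
Qed.

End HomImage.

Section NelsonTwistRepresentation.
Context (d : Order.disp_t) (A : invResidLatticeType d) (n : nelsonConucleus A).
Implicit Types x y : A.

Lemma corestr_val (a : conuc_image n) : corestr n (val a) = a.
Proof. by apply: val_inj; apply: corestr_fix. Qed.

Lemma corestrU x y : corestr n (x `|` y) = corestr n x `|` corestr n y.
Proof. by apply: val_inj; apply: nelsonU. Qed.

Lemma corestrM x y : corestr n (x * y) = corestr n x * corestr n y.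
Proof. by apply: val_inj; apply: nelsonM. Qed.

(** An element of the image lies below [corestr n x] iff it lies below [x], so both sides have the
    same lower bounds, even if [n] does not preserve the meets of [A]. *)
Lemma corestrI x y : corestr n (x `&` y) = corestr n x `&` corestr n y.
Proof. by apply: eq_from_le => z; rewrite lexI !le_corestr lexI. Qed.

(** Left to right uses [n x <= x], right to left the Nelson inequality. *)
Lemma nelson_mulr_le x y z w :
  (x * y * z <= w) = (n x * y * z <= w) && (x * n y * z <= w).
Proof.
rewrite !(rdivP _ z) -leUx; apply/idP/idP; last exact/le_trans/nelson_mul_le.
by apply: le_trans; rewrite leUx !mul_mono ?conuc_le.
Qed.

(** For [z] in the image, [z <= neg (x * y)] splits into bounds by [neg 1] on [n x * y * z] and
    [x * n y * z]. With [z] rotated to the front, the first puts [z] below the right residual; the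
    second puts it below the left one. *)
Lemma corestr_negM x y :
  corestr n (neg (x * y)) =
  (corestr n (neg y) \rd corestr n x) `&` (corestr n y \ld corestr n (neg x)).
Proof.
apply: eq_from_le => z.
rewrite lexI -rdivP -ldivP !le_corestr -mul_le_neg1 nelson_mulr_le /=.
rewrite -[_ <= neg y]mul_le_neg1' -[_ <= neg x]mul_le_neg1 !mulgA.
by rewrite [X in X && _]mulC_le_neg1 mulgA.
Qed.

Lemma corestr_neg_conuc x :
  corestr n (neg (n x)) = corestr n x \ld nelson_iota n.
Proof. by apply: eq_from_le => z; rewrite -ldivP !le_corestr mul_le_neg1. Qed.

Lemma nelson_phi_hom :
  nelson_hom n (n_Tw (nelson_iota_cyclic n)) (nelson_phi n).
Proof.
apply: nelson_hom_of_meet_mul_neg => [x y|x y|x||x]; apply: tw_eq => //=.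
- exact: corestrI.
- by rewrite neg_meet corestrU.
- exact: corestrM.
- exact: corestr_negM.
- by rewrite negK.
- by apply: val_inj; apply: nelson1.
- by apply: val_inj; apply: conuc_idem.
(* Cyclicity identifies the two residuals in [tw_emb], so their meet collapses. *)
- by rewrite -nelson_iota_cyclic meetxx corestr_neg_conuc.
Qed.

(** Both terms bounding [x * neg y] lie below [neg 1], since [n x <= n y <= y] and
    [n (neg y) <= n (neg x) <= neg x]. *)
Lemma le_of_conuc_le x y : n x <= n y -> n (neg y) <= n (neg x) -> x <= y.
Proof.
move=> xy yx; rewrite le_mul_neg; apply: le_trans (@nelson_mul_le _ _ n _ _) _.
rewrite leUx mul_le_neg1' negK (le_trans xy) ?conuc_le //=.
by rewrite mul_le_neg1 (le_trans yx) ?conuc_le.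
Qed.

Lemma nelson_phi_inj : injective (nelson_phi n).
Proof.
move=> x y [nxy nxy']; apply/le_anti/andP.
by split; apply: le_of_conuc_le; rewrite ?nxy ?nxy'.
Qed.

Lemma nelson_phi_emb (a : conuc_image n) :
  sub_set (hom_range nelson_phi_hom) (tw_emb (nelson_iota_cyclic n) a).
Proof.
(* The witness equals [val a]; written with [n], its image is a value of [n_Tw], hence of
   [tw_emb]. *)
exists (n (val a)) => //; rewrite (hom_conuc nelson_phi_hom).
exact: (congr1 (tw_emb (nelson_iota_cyclic n)) (corestr_val a)).
Qed.

Definition nelson_twist : twist_product (nelson_iota_cyclic n) :=
  TwistProduct nelson_phi_emb.

Lemma nelson_phi_iso :
  nelson_iso n (n_tp nelson_twist) (hom_corestr nelson_phi_hom).
Proof.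
split; last exact: (hom_corestr_bij nelson_phi_hom nelson_phi_inj).
have [hI hU hM hld hrd hN h1 hn] := nelson_phi_hom.
split; try (by move=> x y; apply: val_inj; rewrite /= ?hI ?hU ?hM ?hld ?hrd).
- by move=> x; apply: val_inj; apply: hN.
- by apply: val_inj; apply: h1.
- by move=> x; apply: val_inj; apply: hn.
Qed.

End NelsonTwistRepresentation.

Theorem theorem18 (d : Order.disp_t) (A : invResidLatticeType d)
    (n : nelsonConucleus A) :
  [/\ nelson_hom n (n_Tw (nelson_iota_cyclic n)) (nelson_phi n),
      injective (nelson_phi n)
    & exists (S : twist_product (nelson_iota_cyclic n)) (f : A -> sub_carrier S),
        nelson_iso n (n_tp S) f].
Proof.
split; [exact: nelson_phi_hom | exact: nelson_phi_inj |].
by exists (nelson_twist n), (hom_corestr (nelson_phi_hom n)); apply: nelson_phi_iso.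
Qed.
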